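(* For every integer $n\geq0$, $$\sum_{\pi\in P_n}\mathrm{swrec}(\pi)=\frac{3}{4}(B_{n+3}-B_{n+2})-\left(n+\frac{7}{4}\right)B_{n+1}-\frac{1}{2}(n+1)B_n,$$ where $B_m$ denotes the $m$-th Bell number.
   Context: A partition of $[n]=\{1,\dots,n\}$ is a collection $\{B_1,\dots,B_k\}$ of nonempty, pairwise disjoint subsets with union $[n]$, with $\min B_1<\cdots<\min B_k$. Its canonical sequential form is the word $\pi=\pi_1\cdots\pi_n$ where $i\in B_{\pi_i}$. $P_n$ denotes the set of all partitions of $[n]$, identified with their canonical sequential forms; $|P_n|=B_n$ is the Bell number. In a word $\pi=\pi_1\cdots\pi_n$, the entry $\pi_i$ is a record (at position $i$) if $\pi_i>\pi_j$ for all $j<i$. The statistic $\mathrm{swrec}(\pi)$ is the sum over all records $\pi_i$ of $\pi$ of $i\cdot\pi_i$; e.g. $\mathrm{swrec}(121132)=1\cdot1+2\cdot2+3\cdot5=20$. *)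

(* Defs.v *)
From mathcomp Require Import all_boot all_order all_algebra.

Set Implicit Arguments.
Unset Strict Implicit.
Unset Printing Implicit Defensive.

(* The ground set [n] = {1, ..., n} is represented by 'I_n, the ordinal i
   standing for the integer i + 1; positions in a word are likewise counted
   from 0, while its letters are the actual values 1, 2, ... *)

Definition set_partitions (n : nat) : {set {set {set 'I_n}}} :=
  [set P | partition P [set: 'I_n]].

Definition bell (n : nat) : nat := #|set_partitions n|.

(* The value n is the junk minimum of the empty block, which never belongs to
   a partition. *)
Definition block_min (n : nat) (B : {set 'I_n}) : nat :=
  \big[minn/n]_(i in B) (i : nat).

Definition ordered_blocks (n : nat) (P : {set {set 'I_n}}) : seq {set 'I_n} :=
  sort (fun B C => block_min B <= block_min C) (enum P).

Definition canonical_form (n : nat) (P : {set {set 'I_n}}) : seq nat :=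
  [seq (index (pblock P i) (ordered_blocks P)).+1 | i <- enum 'I_n].

Definition is_record (w : seq nat) (i : nat) : bool :=
  all (fun x => x < nth 0 w i) (take i w).

Definition swrec (w : seq nat) : nat :=
  \sum_(0 <= i < size w | is_record w i) i.+1 * nth 0 w i.

(* Main.v *)
(** Canonical forms are exactly the restricted growth words, and these are
    generated by appending letters: a word with maximum [k] is extended by one
    of its [k] letters, which leaves [swrec] unchanged, or by the record
    [k + 1].  Let [X] be multiplication by [k], [D] the shift
    [f k |-> f (k + 1)] and [L = X + D] on functions of the number [k] of
    blocks.  Writing [M_n f] for the sum of [f k] over partitions of [n], one
    has [M_(n+1) f = M_n (L f)], while summing [swrec * f k] gives

      [W_(n+1) f = W_n (L f) + (n + 1) M_n (D X f)].

    From [D X - X D = D] one gets [D X = L H - H L] with [H = X (X + 1) / 2]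
    and [2 H = X L + L - (L H - H L)], so the sum solving the recurrence
    telescopes twice, to [W_n f = M_n (Q_n f)] with [Q_n] in closed form.  At
    [f = 1] this is a combination of [B_(n+j) = M_n (L^j 1)], [j <= 3]. *)

Require Import Defs.
From mathcomp Require Import all_boot all_order all_algebra.
From mathcomp Require Import zify ring.

Set Implicit Arguments.
Unset Strict Implicit.
Unset Printing Implicit Defensive.

(** * Block minima and restricted growth words *)

Lemma block_minP (n : nat) (B : {set 'I_n}) :
  B != set0 ->
  exists2 i : 'I_n, i \in B /\ block_min B = i & forall j, j \in B -> i <= j.
Proof.
case/set0Pn=> i0 Bi0; case: (arg_minnP (fun i : 'I_n => i : nat) Bi0) => i Bi imin.
exists i => //; split=> //; apply/eqP; rewrite eqn_leq; apply/andP; split.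
  rewrite /block_min -big_filter.
  have: i \in [seq j <- index_enum 'I_n | j \in B].
    by rewrite mem_filter mem_index_enum andbT.
  elim: [seq _ <- _ | _] => // k s IHs; rewrite inE big_cons => /orP[/eqP->|/IHs].
    exact: geq_minl.
  by move=> le_s; rewrite (leq_trans (geq_minr _ _)).
(* The default [n] of the minimum is harmless here, because [i < n]. *)
rewrite /block_min; elim/big_ind: _ => [|x y ix iy|j /imin //].
  exact: ltnW.
by rewrite leq_min ix iy.
Qed.

(** The condition asks for earlier occurrences of all smaller letters, since the order of block
    minima yields exactly this; [restricted_growth_rcons_max] recovers the usual bound by one plus
    the running maximum. *)
Definition restricted_growth (w : seq nat) : Prop :=
  forall i, i < size w ->
    0 < nth 0 w i /\ forall v, 0 < v < nth 0 w i -> v \in take i w.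

Definition word_max (w : seq nat) : nat := \max_(x <- w) x.

Lemma restricted_growth_rcons (w : seq nat) (a : nat) :
  restricted_growth (rcons w a) <->
  [/\ restricted_growth w, 0 < a & forall v, 0 < v < a -> v \in w].
Proof.
split=> [gwa | [gw a_gt0 aw] i].
  split=> [i lt_i||].
  - have := gwa i; rewrite size_rcons ltnS ltnW // => /(_ isT).
    by rewrite nth_rcons lt_i -cats1 takel_cat // ltnW.
  - by have := gwa (size w); rewrite size_rcons ltnSn nth_rcons ltnn eqxx => /(_ isT)[].
  - have := gwa (size w); rewrite size_rcons ltnSn nth_rcons ltnn eqxx => /(_ isT)[_].
    by rewrite -cats1 take_size_cat.
rewrite size_rcons ltnS leq_eqVlt => /orP[/eqP-> | lt_i].
  by rewrite nth_rcons ltnn eqxx -cats1 take_size_cat.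
rewrite nth_rcons lt_i -cats1 takel_cat ?(ltnW lt_i) //.
exact: gw.
Qed.

Lemma word_max_rcons (w : seq nat) (a : nat) :
  word_max (rcons w a) = maxn (word_max w) a.
Proof. by rewrite /word_max -cats1 big_cat big_seq1. Qed.

(** Induction on the last letter [a]: if [a > 1], then [a.-1] occurs earlier, so the maximum grows
    by at most one and no value is skipped. *)
Lemma mem_restricted_growth (w : seq nat) :
  restricted_growth w -> forall v, (v \in w) = (0 < v <= word_max w).
Proof.
elim/last_ind: w => [_ v|w a IHw /restricted_growth_rcons[gw a_gt0 aw] v].
  by rewrite /word_max big_nil in_nil; case: v.
have {}IHw := IHw gw; rewrite mem_rcons inE word_max_rcons IHw.
have le_a : a <= (word_max w).+1.
  case: a a_gt0 aw => [//|[//|a]] _ /(_ a.+1); rewrite ltnSn IHw => /(_ isT).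
  by [].
lia.
Qed.

Lemma restricted_growth_rcons_max (w : seq nat) (a : nat) :
  restricted_growth (rcons w a) <->
  restricted_growth w /\ 0 < a <= (word_max w).+1.
Proof.
split=> [/restricted_growth_rcons[gw a_gt0 aw] | [gw /andP[a_gt0 le_a]]].
  split=> //; rewrite a_gt0 /=.
  case: a a_gt0 aw => [//|[//|a]] _ /(_ a.+1).
  by rewrite ltnSn mem_restricted_growth // => /(_ isT).
apply/restricted_growth_rcons; split=> // v /andP[v_gt0 lt_va].
by rewrite mem_restricted_growth // v_gt0 -ltnS (leq_trans lt_va).
Qed.

Fixpoint growth_words (n : nat) : seq (seq nat) :=
  if n is m.+1 then
    [seq rcons w a | w <- growth_words m, a <- iota 1 (word_max w).+1]
  else [:: [::]].

Lemma growth_wordsP (n : nat) (w : seq nat) :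
  w \in growth_words n <-> size w = n /\ restricted_growth w.
Proof.
elim: n w => [|n IHn] w.
  by rewrite inE; split=> [/eqP->|[/size0nil->]].
split=> [/allpairsPdep[u [a [/IHn[su gu] + ->]]] | ].
  rewrite mem_iota => /andP[a_gt0 lt_a]; rewrite size_rcons su; split=> //.
  by apply/restricted_growth_rcons_max; split; rewrite // a_gt0.
case: (lastP w) => [[]|u a] //; rewrite size_rcons => -[[su]].
case/restricted_growth_rcons_max=> gu /andP[a_gt0 le_a].
apply/allpairsPdep; exists u, a; split=> //; first exact/IHn.
by rewrite mem_iota a_gt0.
Qed.

Lemma growth_words_uniq (n : nat) : uniq (growth_words n).
Proof.
elim: n => // n IHn.
apply: (@allpairs_uniq_dep (seq nat) (fun=> nat) (seq nat) (@rcons nat)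
  (growth_words n) (fun w => iota 1 (word_max w).+1)) => // [w _|].
  exact: iota_uniq.
by move=> [u a] [v b] _ _ /= /rcons_inj[-> ->].
Qed.

(* A restricted growth word is determined by its kernel: a new letter is the
   least one not used before, any other letter repeats an earlier position. *)
Lemma restricted_growth_ker_inj (u w : seq nat) :
  restricted_growth u -> restricted_growth w -> size u = size w ->
  (forall i j, i < j < size u ->
     (nth 0 u i == nth 0 u j) = (nth 0 w i == nth 0 w j)) ->
  u = w.
Proof.
elim/last_ind: u w => [|u a IHu] w; first by case: w.
case/lastP: w => [|w b]; rewrite !size_rcons // => gua gwb [suw] ker.
case/restricted_growth_rcons: gua => gu a_gt0 au.
case/restricted_growth_rcons: gwb => gw b_gt0 bw.
have uw : u = w.
  apply: IHu => // i j /andP[lt_ij lt_j].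
  have := ker i j; rewrite lt_ij ltnS (ltnW lt_j) => /(_ isT).
  by rewrite !nth_rcons -suw lt_j (ltn_trans lt_ij lt_j).
rewrite -{w suw}uw in gw bw ker *; congr rcons.
have repeat i : i < size u -> (nth 0 u i == a) = (nth 0 u i == b).
  move=> lt_i; have := ker i (size u); rewrite lt_i ltnSn => /(_ isT).
  by rewrite !nth_rcons lt_i ltnn eqxx.
have [/(nthP 0)[i lt_i ui]|a_new] := boolP (a \in u).
  by have := repeat i lt_i; rewrite ui eqxx => /esym/eqP.
have [/(nthP 0)[i lt_i ui]|b_new] := boolP (b \in u).
  by have := repeat i lt_i; rewrite ui eqxx => /eqP.
case: (ltngtP a b) => // [lt_ab|lt_ba].
  by case/negP: a_new; apply: bw; rewrite a_gt0.
by case/negP: b_new; apply: au; rewrite b_gt0.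
Qed.

(** * Bijection between set partitions and restricted growth words *)

Lemma size_canonical_form (n : nat) (P : {set {set 'I_n}}) :
  size (canonical_form P) = n.
Proof. by rewrite size_map size_enum_ord. Qed.

Lemma mem_ordered_blocks (n : nat) (P : {set {set 'I_n}}) :
  ordered_blocks P =i P.
Proof. by move=> B; rewrite mem_sort mem_enum. Qed.

Lemma nth_canonical_form (n : nat) (P : {set {set 'I_n}}) (i : 'I_n) :
  nth 0 (canonical_form P) i = (index (pblock P i) (ordered_blocks P)).+1.
Proof.
by rewrite (nth_map i) ?size_enum_ord // nth_ord_enum.
Qed.

Lemma partition_pblock_mem (n : nat) (P : {set {set 'I_n}}) (i : 'I_n) :
  partition P [set: 'I_n] -> pblock P i \in P.
Proof. by move=> partP; rewrite pblock_mem // (cover_partition partP) inE. Qed.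

Lemma canonical_form_ker (n : nat) (P : {set {set 'I_n}}) (i j : 'I_n) :
  partition P [set: 'I_n] ->
  (nth 0 (canonical_form P) i == nth 0 (canonical_form P) j)
  = (pblock P i == pblock P j).
Proof.
move=> partP; rewrite !nth_canonical_form eqSS; apply/eqP/eqP => [|-> //].
by apply: (index_inj set0); rewrite mem_ordered_blocks partition_pblock_mem.
Qed.

(** A smaller letter labels a block with smaller minimum [j]. The block of [i] has its own minimum
    [l <= i], so [j < l <= i], and the smaller letter occurs at position [j]. *)
Lemma canonical_form_growth (n : nat) (P : {set {set 'I_n}}) :
  partition P [set: 'I_n] -> restricted_growth (canonical_form P).
Proof.
move=> partP; have [_ tiP P0] := and3P partP.
move=> k; rewrite size_canonical_form => lt_k; pose i := Ordinal lt_k.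
rewrite -[k]/(i : nat) nth_canonical_form; split=> // -[//|v] /=.
set s := ordered_blocks P; set q := index _ _; rewrite ltnS => lt_vq.
have s_i : pblock P i \in s by rewrite mem_ordered_blocks partition_pblock_mem.
have lt_qs : q < size s by rewrite index_mem.
have lt_vs := ltn_trans lt_vq lt_qs.
have s_v : nth set0 s v \in P by rewrite -mem_ordered_blocks mem_nth.
have block_n0 B : B \in P -> B != set0 by apply: contraTneq => ->.
have [j [Bj minj] _] := block_minP (block_n0 _ s_v).
have [l [Bl minl] le_l] := block_minP (block_n0 _ (partition_pblock_mem i partP)).
have s_uniq : uniq s by rewrite sort_uniq enum_uniq.
have sP : nth set0 s q = pblock P i by rewrite nth_index.
have Pj : pblock P j = nth set0 s v by apply: def_pblock.
have le_jl : j <= l.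
  rewrite -minj -minl -sP.
  pose leB (B C : {set 'I_n}) := block_min B <= block_min C.
  have leB_tr : transitive leB by move=> ? ? ?; apply: leq_trans.
  have leB_refl : reflexive leB by move=> ?; apply: leqnn.
  apply: (sorted_leq_nth leB_tr leB_refl set0) => //; last exact: ltnW.
  by apply: sort_sorted => B C; apply: leq_total.
(* Equal minima would make the two blocks coincide, forcing their indices [v] and [q] to be
   equal. *)
have neq_jl : j != l.
  apply: contraTneq lt_vq => jl; rewrite -leqNgt.
  have Pl : pblock P l = pblock P i by apply: def_pblock => //; apply: partition_pblock_mem.
  by rewrite /q -Pl -jl Pj index_uniq.
have le_li : l <= i by apply: le_l; rewrite mem_pblock (cover_partition partP).
have lt_ji : j < i.
  by apply: leq_trans le_li; rewrite ltn_neqAle le_jl andbT.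
have <- : nth 0 (canonical_form P) j = v.+1.
  by rewrite nth_canonical_form Pj index_uniq.
rewrite -(nth_take 0 lt_ji) mem_nth // size_takel // size_canonical_form.
exact: ltnW.
Qed.

(** The word tells which elements share a block, and a partition is recovered from this relation as
    the fibres of [pblock]. *)
Lemma canonical_form_inj (n : nat) :
  {in set_partitions n &, injective (@canonical_form n)}.
Proof.
move=> P Q; rewrite !inE => partP partQ PQ.
rewrite -(preim_partition_pblock partP) -(preim_partition_pblock partQ).
rewrite /preim_partition /equivalence_partition; apply: eq_imset => x /=.
by apply/setP=> y; rewrite !inE -!canonical_form_ker // PQ.
Qed.

(** This gives surjectivity: taking positions with equal letters as blocks produces a canonical form
    with the same kernel as [w], and [restricted_growth_ker_inj] applies. *)
Lemma canonical_form_preim (n : nat) (w : seq nat) :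
  size w = n -> restricted_growth w ->
  canonical_form (preim_partition (fun i : 'I_n => nth 0 w i) [set: 'I_n]) = w.
Proof.
move=> sw gw; set P := preim_partition _ _.
have partP : partition P [set: 'I_n] by apply: preim_partitionP.
apply: restricted_growth_ker_inj => //; rewrite ?size_canonical_form ?sw //.
  exact: canonical_form_growth.
move=> i j /andP[lt_ij lt_j].
pose io := Ordinal (ltn_trans lt_ij lt_j); pose jo := Ordinal lt_j.
have := canonical_form_ker io jo partP; rewrite /= => ->.
have [_ tiP _] := and3P partP.
rewrite eq_pblock ?(cover_partition partP) ?inE //.
by rewrite pblock_equivalence_partition ?inE // => x y z _ _ _; split=> // /eqP->.
Qed.

Lemma perm_canonical_form (n : nat) :
  perm_eq [seq canonical_form P | P <- enum (set_partitions n)] (growth_words n).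
Proof.
apply: uniq_perm; last 1 first; rewrite ?growth_words_uniq //.
- move=> w; apply/mapP/idP => [[P] | /growth_wordsP[sw gw]].
    rewrite mem_enum inE => partP ->; apply/growth_wordsP.
    by rewrite size_canonical_form; split=> //; apply: canonical_form_growth.
  exists (preim_partition (fun i : 'I_n => nth 0 w i) [set: 'I_n]).
    by rewrite mem_enum inE preim_partitionP.
  by rewrite canonical_form_preim.
- rewrite map_inj_in_uniq ?enum_uniq // => P Q; rewrite !mem_enum.
  exact: canonical_form_inj.
Qed.

Lemma bell_growth_words (n : nat) : bell n = size (growth_words n).
Proof. by rewrite -(perm_size (perm_canonical_form n)) size_map -cardE. Qed.

Lemma sum_canonical_form (n : nat) (F : seq nat -> nat) :
  \sum_(P in set_partitions n) F (canonical_form P)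
  = \sum_(w <- growth_words n) F w.
Proof. by rewrite -(perm_big _ (perm_canonical_form n)) big_map big_enum. Qed.

(** * Effect of an appended letter on [swrec] *)

Lemma swrec_rcons (w : seq nat) (a : nat) :
  swrec (rcons w a) = swrec w + all (ltn^~ a) w * ((size w).+1 * a).
Proof.
rewrite /swrec size_rcons big_mkcond big_nat_recr //= [in RHS]big_mkcond /=.
congr (_ + _).
  apply: eq_big_nat => i /andP[_ lt_i].
  by rewrite /is_record nth_rcons lt_i -cats1 takel_cat // ltnW.
rewrite /is_record nth_rcons ltnn eqxx -cats1 take_size_cat //.
by case: all; rewrite ?mul1n.
Qed.

Lemma swrec_rcons_repeat (w : seq nat) (a : nat) :
  restricted_growth w -> 0 < a <= word_max w -> swrec (rcons w a) = swrec w.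
Proof.
move=> gw /andP[a_gt0 le_a]; rewrite swrec_rcons.
suff -> : all (ltn^~ a) w = false by rewrite addn0.
(* The maximum is positive, hence occurs in [w], and it is not below [a]; so [a] is no record. *)
apply/negbTE/allPn; exists (word_max w); last by rewrite -leqNgt.
by rewrite mem_restricted_growth // (leq_trans a_gt0) /=.
Qed.

Lemma swrec_rcons_new (w : seq nat) :
  swrec (rcons w (word_max w).+1)
  = swrec w + (size w).+1 * (word_max w).+1.
Proof.
rewrite swrec_rcons; suff -> : all (ltn^~ (word_max w).+1) w by rewrite mul1n.
by apply/allP=> x xw; rewrite /= ltnS /word_max (leq_bigmax_seq (F := id)).
Qed.

(** * Recurrences for sums over growth words and their solution *)

Local Open Scope ring_scope.
Import GRing.Theory.

(* [block_sum n f] and [swrec_sum n f] are the sums of [f k] and of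
   [swrec * f k] over the partitions of [n], [k] being the number of blocks. *)
Definition block_sum (n : nat) (f : nat -> rat) : rat :=
  \sum_(w <- growth_words n) f (word_max w).

Definition swrec_sum (n : nat) (f : nat -> rat) : rat :=
  \sum_(w <- growth_words n) (swrec w)%:R * f (word_max w).

(* The operator [L]. *)
Definition insertion (f : nat -> rat) (k : nat) : rat := k%:R * f k + f k.+1.

Lemma growth_words_sumS (n : nat) (F G : seq nat -> rat) :
  (forall w, size w = n -> restricted_growth w ->
     \sum_(a <- iota 1 (word_max w).+1) F (rcons w a) = G w) ->
  \sum_(w <- growth_words n.+1) F w = \sum_(w <- growth_words n) G w.
Proof.
move=> FG; rewrite [LHS](@big_allpairs_dep _ _ _ _ (fun=> nat) _ (@rcons nat)
  (growth_words n) (fun w => iota 1 (word_max w).+1)).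
rewrite big_seq [RHS]big_seq.
by apply: eq_bigr => w /growth_wordsP[sw gw]; rewrite FG.
Qed.

Lemma sum_iota_recr (m : nat) (F : nat -> rat) (c : rat) :
  (forall a, (0 < a <= m)%N -> F a = c) ->
  \sum_(a <- iota 1 m.+1) F a = m%:R * c + F m.+1.
Proof.
move=> Fc; rewrite -(addn1 m) iotaD big_cat big_seq1 add1n addn1; congr (_ + _).
rewrite big_seq (eq_bigr (fun=> c)) => [|a]; last first.
  by rewrite mem_iota add1n ltnS; apply: Fc.
by rewrite -big_seq big_const_seq count_predT size_iota iter_addr_0 mulr_natl.
Qed.

Lemma block_sumS (n : nat) (f : nat -> rat) :
  block_sum n.+1 f = block_sum n (insertion f).
Proof.
apply: growth_words_sumS => w _ _.
rewrite (@sum_iota_recr _ _ (f (word_max w))) => [|a /andP[_ le_a]].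
  by rewrite word_max_rcons (maxn_idPr _) // leqnSn.
by rewrite word_max_rcons (maxn_idPl _).
Qed.

Lemma swrec_sumS (n : nat) (f : nat -> rat) :
  swrec_sum n.+1 f = swrec_sum n (insertion f)
    + block_sum n (fun k => (n%:R + 1) * (k%:R + 1) * f k.+1).
Proof.
rewrite /block_sum -big_split; apply: growth_words_sumS => w sw gw.
rewrite (@sum_iota_recr _ _ ((swrec w)%:R * f (word_max w))) => [|a le_a].
  rewrite word_max_rcons (maxn_idPr _) ?leqnSn // swrec_rcons_new sw /insertion.
  by rewrite natrD natrM -!natr1 /=; ring.
by rewrite word_max_rcons swrec_rcons_repeat // (maxn_idPl _) //; case/andP: le_a.
Qed.

(* The operator [Q_n = (n + 1) (H - (L^2 + L) / 2) + (L X L + L H) / 2]. *)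
Definition swrec_op (n : nat) (f : nat -> rat) (k : nat) : rat :=
  let X h j : rat := j%:R * h j in
  let H h j : rat := j%:R * (j%:R + 1) / 2 * h j in
  (n%:R + 1) * (H f k - (insertion (insertion f) k + insertion f k) / 2)
  + (insertion (X (insertion f)) k + insertion (H f) k) / 2.

(** Induction on [n] for all [f] at once. The two recurrences reduce the step to the operator
    identity [Q_n L + (n + 1) D X = L Q_(n+1)], checked pointwise. *)
Lemma swrec_sumE (n : nat) (f : nat -> rat) :
  swrec_sum n f = block_sum n (swrec_op n f).
Proof.
elim: n f => [|n IHn] f.
  rewrite /swrec_sum /block_sum /= !big_seq1 /word_max big_nil.
  have -> : swrec [::] = 0%N by rewrite /swrec big_nil.
  (* Only [k = 0] remains, where the terms of [Q_0 f] in [f 1] and [f 2] cancel. *)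
  by rewrite /swrec_op /insertion; field.
rewrite swrec_sumS IHn block_sumS /block_sum -big_split /=.
apply: eq_bigr => w _; rewrite /swrec_op /insertion -!natr1.
by field.
Qed.

Lemma bell_block_sum (n : nat) : (bell n)%:R = block_sum n (fun=> 1).
Proof.
by rewrite bell_growth_words /block_sum big_const_seq count_predT iter_addr_0.
Qed.

Theorem theorem3 (n : nat) :
  (\sum_(P in set_partitions n) swrec (canonical_form P))%N%:R
  = 3 / 4 * ((bell n.+3)%:R - (bell n.+2)%:R)
    - (n%:R + 7 / 4) * (bell n.+1)%:R
    - 1 / 2 * (n%:R + 1) * (bell n)%:R :> rat.
Proof.
have -> : (\sum_(P in set_partitions n) swrec (canonical_form P))%N%:R
          = swrec_sum n (fun=> 1).
  by rewrite sum_canonical_form natr_sum; apply: eq_bigr => w _; rewrite mulr1.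
rewrite swrec_sumE !bell_block_sum !block_sumS /block_sum.
(* The equality holds word by word: both summands are the same cubic polynomial in [word_max w]. *)
rewrite -sumrB !mulr_sumr -!sumrB; apply: eq_bigr => w _.
rewrite /swrec_op /insertion -!natr1.
by field.
Qed.
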